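(* Consider the ATP problem with identical request distributions $\mathcal D_1=\dots=\mathcal D_T=\mathcal D$ (of finite support) with symmetric prices, i.e. $b=s$ for every tuple $(b,s)$ in the support of $\mathcal D$, and initial inventory $B_0\ge 1$. (a) There is an absolute constant $C>0$ such that for every such instance with capacity $B\ge 2$ there exists an online algorithm whose expected profit is at least $\left(1-C\,\frac{\log B}{\sqrt{B}}\right)$ times the expected profit of the optimal offline algorithm. (b) There are absolute constants $c>0$ and $n_0$ such that for every integer $B\ge n_0$ there is such an instance with capacity $B$, whose optimal offline algorithm has positive expected profit $\mathrm{OPT}$, and on which every online algorithm has expected profit at most $\left(1-\frac{c}{\sqrt{B}}\right)\mathrm{OPT}$.
   Context: ATP (Asymmetric Trading Prophets) problem. A decision maker interacts with $T$ sequentially arriving requests to trade copies of a product. She has capacity $B\ge 1$ (she may hold at most $B$ copies at any time) and starts with an initial inventory of $B_0\in\{0,\dots,B\}$ copies. It is assumed throughout that $T\ge B_0$ and $B\le B_0+T$. At time $t\in\{1,\dots,T\}$ a price tuple $(b_t,s_t)$ of nonnegative prices is revealed, where $b_t$ is the cost of buying a copy and $s_t$ is the revenue from selling a copy; $(b_t,s_t)$ is drawn from a known distribution $\mathcal D_t$, independently across $t$. At time $t$ she takes exactly one action: Buy one copy at price $b_t$ (allowed if she holds at most $B-1$ copies), Sell one copy at price $s_t$ (allowed if she holds at least one copy), or Skip. Profit is total revenue from sales minus total cost of purchases. An online algorithm (possibly randomized) chooses its action at time $t$ knowing only the distributions, the tuples revealed up to and including time $t$, and its past actions. The optimal offline algorithm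 knows all realized tuples in advance and attains the maximum possible profit for each realization; its expected profit is the expectation of this maximum. *)

(* Defs.v *)
From HB Require Import structures.
From mathcomp Require Import all_boot all_order all_algebra finmap.
From mathcomp Require Import reals sequences exp.

Set Implicit Arguments.
Unset Strict Implicit.
Unset Printing Implicit Defensive.

Import Order.TTheory GRing.Theory Num.Theory.
Local Open Scope ring_scope.

Inductive action := Buy | Sell | Skip.

Definition action_code (a : action) : option bool :=
  match a with Buy => Some true | Sell => Some false | Skip => None end.

Definition action_decode (o : option bool) : action :=
  match o with Some true => Buy | Some false => Sell | None => Skip end.

Lemma action_codeK : cancel action_code action_decode.
Proof. by case. Qed.

HB.instance Definition _ := Equality.copy action (can_type action_codeK).
HB.instance Definition _ := Choice.copy action (can_type action_codeK).
HB.instance Definition _ := Countable.copy action (can_type action_codeK).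
HB.instance Definition _ := Finite.copy action (can_type action_codeK).

(* A price tuple is a pair (b, s): x.1 is the cost of buying a copy, x.2 the
   revenue from selling one.  The support of the distribution is the finite
   set [finsupp pmf]. *)
Record price_dist (R : realType) := PriceDist {
  pmf :> {fsfun R * R -> R with 0};
  pmf_ge0 : forall x, 0 <= pmf x;
  pmf_sum1 : \sum_(x <- finsupp pmf) pmf x = 1;
  prices_ge0 : forall x, x \in finsupp pmf -> 0 <= x.1 /\ 0 <= x.2
}.

Definition symmetric_prices (R : realType) (D : price_dist R) : Prop :=
  forall x, x \in finsupp D -> x.1 = x.2.

(* ATP instances whose requests are all drawn from the same distribution. *)
Record iid_atp (R : realType) := IidATP {
  horizon : nat;
  capacity : nat;
  inventory : nat;
  request : price_dist R;
  capacity_gt0 : (1 <= capacity)%N;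
  inventory_capacity : (inventory <= capacity)%N;
  inventory_horizon : (inventory <= horizon)%N;
  capacity_horizon : (capacity <= inventory + horizon)%N
}.

(* [feasible B n acts]: the actions [acts] can be performed in this order with
   capacity [B] when starting with [n] copies. *)
Fixpoint feasible (B n : nat) (acts : seq action) : bool :=
  match acts with
  | [::] => true
  | Buy :: acts' => (n < B)%N && feasible B n.+1 acts'
  | Sell :: acts' => (0 < n)%N && feasible B n.-1 acts'
  | Skip :: acts' => feasible B n acts'
  end.

Definition gain (R : realType) (x : R * R) (a : action) : R :=
  match a with Buy => - x.1 | Sell => x.2 | Skip => 0 end.

Definition profit (R : realType) (ps : seq (R * R)) (acts : seq action) : R :=
  \sum_(xa <- zip ps acts) gain xa.1 xa.2.

Section Algorithms.
Variables (R : realType) (P : iid_atp R).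

Local Notation T := (horizon P).
Local Notation D := (request P).

Definition realization : finType := T.-tuple (finsupp D).

Definition prices (w : realization) : seq (R * R) := map val w.

Definition expectation (X : seq (R * R) -> R) : R :=
  \sum_(w : realization) (\prod_(x <- prices w) D x) * X (prices w).

(* The default value 0 of the maximum is the profit of the feasible sequence
   that always skips. *)
Definition max_profit (ps : seq (R * R)) : R :=
  \big[Num.max/0]_(a : T.-tuple action | feasible (capacity P) (inventory P) a)
     profit ps a.

Definition offline_profit : R := expectation max_profit.

(* Randomized algorithms as behavioural strategies: [A ps acts a] is the
   probability of choosing [a] at the current time, given the tuples [ps]
   revealed so far (including the current one) and the past actions [acts]. *)
Definition algorithm : Type := seq (R * R) -> seq action -> action -> R.

Definition is_online (A : algorithm) : Prop :=
  forall (ps : seq (R * R)) (acts : seq action),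
    (size acts < T)%N -> size ps = (size acts).+1 ->
    {subset ps <= finsupp D} ->
    feasible (capacity P) (inventory P) acts ->
    [/\ forall a, 0 <= A ps acts a,
        \sum_(a : action) A ps acts a = 1
      & forall a, 0 < A ps acts a ->
          feasible (capacity P) (inventory P) (rcons acts a)].

Definition action_prob (A : algorithm) (ps : seq (R * R))
    (acts : T.-tuple action) : R :=
  \prod_(t < T) A (take t.+1 ps) (take t acts) (tnth acts t).

Definition online_profit (A : algorithm) : R :=
  expectation (fun ps =>
    \sum_(acts : T.-tuple action) action_prob A ps acts * profit ps acts).

End Algorithms.

(* Main.v *)
Require Import Defs.
From mathcomp Require Import all_boot all_order all_algebra finmap.
From mathcomp Require Import reals sequences exp.
From mathcomp Require Import zify ring lra.
Import Order.TTheory GRing.Theory Num.Theory.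
Local Open Scope ring_scope.

(* Part (a).  Dualizing the constraint "net sales <= B_0" with a multiplier [lam] bounds the
   offline profit by [T * E|p - lam| + lam * B_0].  Put [delta = B_0 / T] and let [lam] be the
   [(1 - delta) / 2]-quantile of the price.  Buying below [lam] and selling above it (ties being
   randomized) is optimal for the dual in every step and lets the stock follow the line
   [delta * (remaining time)] up to martingale fluctuations.  The policy departs from it only
   when the stock is empty, full, or just sufficient to keep selling until the end; each
   departure costs at most a constant times the average dual profit of a step, and an explicit
   supermartingale bounds their expected number by [44 T / sqrt B].  No logarithm is needed.

   Part (b).  Prices 0, 1, 2, with 1 of probability [e] of order [1 / sqrt B], horizon of order
   [B], initial stock of order [sqrt B], and a capacity that never binds.  Buying at 0 and
   selling at 2 is always right.  At price 1 the right action depends on whether a sale at 2 will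
   be missed later for lack of stock; both futures have probability bounded below, so that each
   of the order [sqrt B] early requests at price 1 costs a constant in expectation. *)

(** * Dynamic programming for online and offline profit *)

Definition restock (n : nat) (a : action) : nat :=
  match a with Buy => n.+1 | Sell => n.-1 | Skip => n end.

Definition allowed (B n : nat) (a : action) : bool :=
  match a with Buy => (n < B)%N | Sell => (0 < n)%N | Skip => true end.

Definition stock (n : nat) (acts : seq action) : nat := foldl restock n acts.

Lemma stock_rcons (n : nat) (acts : seq action) (a : action) :
  stock n (rcons acts a) = restock (stock n acts) a.
Proof. by rewrite /stock foldl_rcons. Qed.

Lemma feasible_rcons (B n : nat) (acts : seq action) (a : action) :
  feasible B n (rcons acts a) = feasible B n acts && allowed B (stock n acts) a.
Proof.
by elim: acts n => [|[] acts IH] n /=; rewrite ?IH ?andbA //; case: a; rewrite /= ?andbT.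
Qed.

Lemma feasible_cons (B n : nat) (acts : seq action) (a : action) :
  feasible B n (a :: acts) = allowed B n a && feasible B (restock n a) acts.
Proof. by case: a. Qed.

(** [f] is the continuation value. The default [f n] of the maximum is the value of [Skip], which is
    always allowed. *)
Definition bellman {R : realType} (B : nat) (x : R * R) (n : nat) (f : nat -> R) : R :=
  \big[Num.max/f n]_(a | allowed B n a) (gain x a + f (restock n a)).

Lemma bellman_ge {R : realType} {B : nat} {x : R * R} {n : nat} {f : nat -> R} (a : action) :
  allowed B n a -> gain x a + f (restock n a) <= bellman B x n f.
Proof. exact: le_bigmax_cond. Qed.

Lemma bellman_le {R : realType} {B : nat} {x : R * R} {n : nat} {f : nat -> R} (c : R) :
  (forall a, allowed B n a -> gain x a + f (restock n a) <= c) -> bellman B x n f <= c.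
Proof. by move=> h; apply/bigmax_leP; split=> //; have := h Skip isT; rewrite /= add0r. Qed.

Lemma bellman_attained {R : realType} (B : nat) (x : R * R) (n : nat) (f : nat -> R) :
  exists2 a, allowed B n a & bellman B x n f = gain x a + f (restock n a).
Proof.
have [h|h] := boolP [exists a, allowed B n a && (bellman B x n f == gain x a + f (restock n a))].
  by case/existsP: h => a /andP[? /eqP]; exists a.
have lt a : allowed B n a -> gain x a + f (restock n a) < bellman B x n f.
  move=> Ba; rewrite lt_neqAle bellman_ge // andbT.
  by move/existsPn/(_ a): h; rewrite Ba /= eq_sym.
suff : bellman B x n f < bellman B x n f by rewrite ltxx.
apply/bigmax_ltP; split; last by move=> a; exact: lt.
by have := lt Skip isT; rewrite /= add0r.
Qed.

(** Optimal online profit with [r] requests left. The maximum lies inside the mean because the price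
    is seen before acting; in [hindsight] the continuation also knows the future prices. *)
Fixpoint value {R : realType} (D : price_dist R) (B r n : nat) : R :=
  if r is r'.+1 then \sum_(x <- finsupp D) D x * bellman B x n (value D B r') else 0.

Fixpoint hindsight {R : realType} (B n : nat) (ps : seq (R * R)) : R :=
  if ps is x :: ps' then bellman B x n (fun n' => hindsight B n' ps') else 0.

Fixpoint mean {R : realType} (D : price_dist R) (r : nat) (f : seq (R * R) -> R) : R :=
  if r is r'.+1 then \sum_(x <- finsupp D) D x * mean D r' (fun ps => f (x :: ps))
  else f [::].

Lemma big_tuple_cons {R : realType} (I : finType) (r : nat) (f : r.+1.-tuple I -> R) :
  \sum_(w : r.+1.-tuple I) f w = \sum_(x : I) \sum_(w : r.-tuple I) f (cons_tuple x w).
Proof.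
rewrite pair_bigA /=.
rewrite (reindex (fun p : I * r.-tuple I => cons_tuple p.1 p.2)) //=.
exists (fun w => (thead w, [tuple of behead w])) => [[x w] _|w _] /=.
  by rewrite theadE; congr pair; apply: val_inj.
by rewrite [RHS]tuple_eta; apply: val_inj.
Qed.

Lemma big_tuple0 {R : realType} (I : finType) (f : 0.-tuple I -> R) :
  \sum_(w : 0.-tuple I) f w = f [tuple].
Proof.
rewrite (eq_bigr (fun=> f [tuple])) => [|w _]; last by rewrite (tuple0 w).
by rewrite big_const card_tuple expn0 /= addr0.
Qed.

Lemma expectation_mean {R : realType} (P : iid_atp R) (X : seq (R * R) -> R) :
  expectation P X = mean (request P) (horizon P) X.
Proof.
rewrite /expectation /realization /prices; move: (request P) (horizon P) => D r.
elim: r X => [|r IH] X /=.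
  by rewrite big_tuple0 /= big_nil mul1r.
rewrite big_tuple_cons [RHS]big_seq_fsetE /=; apply: eq_bigr => x _.
rewrite -IH mulr_sumr; apply: eq_bigr => w _.
by rewrite /= big_cons mulrA.
Qed.

(** Expected final profit given the history, which is kept in full because an algorithm may depend
    on all of it. *)
Fixpoint run {R : realType} (D : price_dist R) (A : algorithm R) (r : nat)
    (ps : seq (R * R)) (acts : seq action) : R :=
  if r is r'.+1 then
    \sum_(x <- finsupp D) D x *
      \sum_(a : action) A (rcons ps x) acts a * run D A r' (rcons ps x) (rcons acts a)
  else profit ps acts.

Lemma online_profit_run {R : realType} (P : iid_atp R) (A : algorithm R) :
  online_profit P A = run (request P) A (horizon P) [::] [::].
Proof.
rewrite /online_profit /expectation /realization /prices /action_prob.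
move: (request P) (horizon P) => D r.
suff H ps acts : size ps = size acts ->
  \sum_(w : r.-tuple (finsupp D)) (\prod_(x <- map val w) D x) *
    (\sum_(u : r.-tuple action)
      (\prod_(t < r) A (ps ++ take t.+1 (map val w)) (acts ++ take t u) (tnth u t)) *
      profit (ps ++ map val w) (acts ++ u)) = run D A r ps acts by exact: (H [::] [::] erefl).
elim: r ps acts => [|r IH] ps acts sz /=.
  by rewrite !big_tuple0 /= big_nil big_ord0 !mul1r !cats0.
rewrite big_tuple_cons [RHS]big_seq_fsetE /=; apply: eq_bigr => x _.
under eq_bigr => w _ do rewrite /= big_cons -mulrA.
rewrite -mulr_sumr; congr (_ * _).
under [RHS]eq_bigr => a _ do rewrite -IH ?size_rcons ?sz // mulr_sumr.
rewrite exchange_big /=; apply: eq_bigr => w _.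
rewrite big_tuple_cons mulr_sumr; apply: eq_bigr => a _.
rewrite mulrCA; congr (_ * _).
rewrite mulr_sumr; apply: eq_bigr => u _.
rewrite big_ord_recl /= take0 cats0 cats1 tnth0 -!cat_rcons.
rewrite mulrA; congr (_ * _ * _).
apply: eq_bigr => t _.
by rewrite /= -!cat_rcons tnthS.
Qed.

Lemma profit_rcons {R : realType} (ps : seq (R * R)) (acts : seq action) (x : R * R) (a : action) :
  size ps = size acts -> profit (rcons ps x) (rcons acts a) = profit ps acts + gain x a.
Proof. by move=> sz; rewrite /profit zip_rcons // big_rcons /= addrC. Qed.

Lemma sum_affine {R : realType} (D : price_dist R) (c : R) (f : R * R -> R) :
  \sum_(x <- finsupp D) D x * (c + f x) = c + \sum_(x <- finsupp D) D x * f x.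
Proof.
under eq_bigr => x _ do rewrite mulrDr.
by rewrite big_split /= -mulr_suml pmf_sum1 mul1r.
Qed.

Lemma ler_mean {R : realType} (D : price_dist R) (f g : R * R -> R) :
  (forall x, x \in finsupp D -> f x <= g x) ->
  \sum_(x <- finsupp D) D x * f x <= \sum_(x <- finsupp D) D x * g x.
Proof.
move=> fg; rewrite !big_seq; apply: ler_sum => x xD.
by rewrite ler_wpM2l ?pmf_ge0 ?fg.
Qed.

Lemma subset_rcons (T : eqType) (s : seq T) (x : T) (A : {pred T}) :
  {subset s <= A} -> x \in A -> {subset rcons s x <= A}.
Proof. by move=> sA xA y; rewrite mem_rcons inE => /predU1P[->//|/sA]. Qed.

(** After any history the algorithm averages over feasible actions, and an average is at most the
    Bellman maximum. *)
Lemma online_profit_le_value {R : realType} (P : iid_atp R) (A : algorithm R) :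
  is_online P A ->
  online_profit P A <= value (request P) (capacity P) (horizon P) (inventory P).
Proof.
move=> onA; rewrite online_profit_run.
set D := request P; set B := capacity P; set T := horizon P; set n0 := inventory P.
suff H r ps acts : (size acts + r = T)%N -> size ps = size acts ->
    {subset ps <= finsupp D} -> feasible B n0 acts ->
    run D A r ps acts <= profit ps acts + value D B r (stock n0 acts).
  by have := H T [::] [::] (erefl T) erefl _ isT; rewrite /profit big_nil add0r; apply.
elim: r ps acts => [|r IH] ps acts szT sz sD fA /=; first by rewrite addr0.
rewrite -sum_affine; apply: ler_mean => x xD.
have [||||A0 A1 Af] := onA (rcons ps x) acts; rewrite ?size_rcons ?sz //.
- by rewrite -/T; lia.
- exact: subset_rcons.
rewrite -[leRHS]mul1r -A1 mulr_suml; apply: ler_sum => a _.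
(* Only actions of positive probability are known to be feasible; the terms of the others vanish. *)
have := A0 a; rewrite le0r => /predU1P[->|Aa]; first by rewrite !mul0r.
rewrite ler_pM2l //.
have := Af a Aa; rewrite feasible_rcons -/B -/n0 fA /= => Ba.
apply: le_trans (IH _ _ _ _ _ _) _; rewrite ?size_rcons ?sz //; first lia.
- exact: subset_rcons.
- by rewrite feasible_rcons fA.
rewrite profit_rcons // stock_rcons -addrA lerD2l.
exact: (bellman_ge (f := value D B r)).
Qed.

Definition best {R : realType} (B : nat) (x : R * R) (n : nat) (f : nat -> R) : action :=
  odflt Skip [pick a | allowed B n a && (bellman B x n f == gain x a + f (restock n a))].

Lemma bestP {R : realType} (B : nat) (x : R * R) (n : nat) (f : nat -> R) :
  allowed B n (best B x n f) /\
  gain x (best B x n f) + f (restock n (best B x n f)) = bellman B x n f.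
Proof.
rewrite /best; case: pickP => [a /andP[? /eqP]|none] //=.
by have [a Ba /eqP ab] := bellman_attained B x n f; have := none a; rewrite Ba ab.
Qed.

Lemma value_attained {R : realType} (P : iid_atp R) :
  exists2 A : algorithm R, is_online P A &
    online_profit P A = value (request P) (capacity P) (horizon P) (inventory P).
Proof.
set D := request P; set B := capacity P; set T := horizon P; set n0 := inventory P.
(* The greedy policy needs only the current price, the stock and the number of requests after the
   current one. The default [(0, 0)] is never read on a nonempty price history. *)
pose act (ps : seq (R * R)) acts :=
  best B (last (0, 0) ps) (stock n0 acts) (value D B (T - (size acts).+1)).
exists (fun ps acts a => (a == act ps acts)%:R) => [ps acts szT sz sD fA|].
  split=> [a||a]; first exact: ler0n.
    by rewrite (bigD1 (act ps acts)) //= eqxx big1 ?addr0 // => a /negPf->.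
  rewrite ltr0n lt0b => /eqP->; rewrite feasible_rcons fA /=.
  by case: (bestP B (last (0, 0) ps) (stock n0 acts) (value D B (T - (size acts).+1))).
rewrite online_profit_run -/D -/T.
set A := (X in run D X).
suff H r ps acts : (size acts + r = T)%N -> size ps = size acts ->
    run D A r ps acts = profit ps acts + value D B r (stock n0 acts).
  have := H T [::] [::] (erefl T) erefl.
  by rewrite /profit big_nil add0r.
elim: r ps acts => [|r IH] ps acts szT sz /=; first by rewrite addr0.
rewrite -sum_affine; apply: eq_bigr => x _; congr (_ * _).
rewrite (bigD1 (act (rcons ps x) acts)) //= big1 ?addr0; last first.
  by move=> a /negPf na; rewrite /A na mul0r.
rewrite /A eqxx mul1r -/A IH ?size_rcons ?sz //; last lia.
rewrite profit_rcons // stock_rcons -addrA; congr (_ + _).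
rewrite /act last_rcons (_ : T - _ = r)%N; last lia.
by case: (bestP B x (stock n0 acts) (value D B r)).
Qed.

Lemma hindsight_le_max_profit {R : realType} (P : iid_atp R) (ps : seq (R * R)) :
  size ps = horizon P -> hindsight (capacity P) (inventory P) ps <= max_profit P ps.
Proof.
rewrite /max_profit => szT.
set B := capacity P; set n := inventory P.
suff [acts [sz fA ->]] : exists acts, [/\ size acts = size ps, feasible B n acts &
    hindsight B n ps = profit ps acts].
  have szA : size acts == horizon P by rewrite sz szT.
  by rewrite (bigmax_sup (Tuple szA)).
elim: ps n {szT} => [|x ps IH] n /=.
  by exists [::]; split=> //; rewrite /profit big_nil.
have [a Ba ->] := bellman_attained B x n (fun n' => hindsight B n' ps).
have [acts [sz fA ->]] := IH (restock n a).
exists (a :: acts); split; first by rewrite /= sz.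
  by rewrite feasible_cons Ba.
by rewrite /profit /= big_cons.
Qed.

Lemma mean_le {R : realType} (D : price_dist R) (r : nat) (f g : seq (R * R) -> R) :
  (forall ps, size ps = r -> {subset ps <= finsupp D} -> f ps <= g ps) ->
  mean D r f <= mean D r g.
Proof.
elim: r f g => [|r IH] f g fg /=; first exact: fg.
apply: ler_mean => x xD; apply: IH => ps sz sD; apply: fg; first by rewrite /= sz.
by move=> y /predU1P[->//|/sD].
Qed.

Lemma meanD {R : realType} (D : price_dist R) (r : nat) (f g : seq (R * R) -> R) :
  mean D r (fun ps => f ps + g ps) = mean D r f + mean D r g.
Proof.
elim: r f g => [|r IH] f g //=.
by rewrite -big_split /=; apply: eq_bigr => x _; rewrite IH mulrDr.
Qed.

Lemma mean_cst {R : realType} (D : price_dist R) (r : nat) (c : R) :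
  mean D r (fun=> c) = c.
Proof. by elim: r => //= r ->; rewrite -mulr_suml pmf_sum1 mul1r. Qed.

(** * The guarantee *)

Lemma eq_mean {R : realType} (D : price_dist R) (r : nat) (f g : seq (R * R) -> R) :
  f =1 g -> mean D r f = mean D r g.
Proof.
by elim: r f g => [|r IH] f g fg /=; rewrite ?fg //;
  apply: eq_bigr => x _; rewrite (IH _ (fun ps => g (x :: ps))).
Qed.

Lemma mean_sum {R : realType} (D : price_dist R) (r : nat) (f : R * R -> R) :
  mean D r (fun ps => \sum_(x <- ps) f x) = r%:R * \sum_(x <- finsupp D) D x * f x.
Proof.
elim: r => [|r IH] /=; first by rewrite big_nil mul0r.
rewrite -natr1 mulrDl mul1r -IH -sum_affine; apply: eq_bigr => x _; congr (_ * _).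
rewrite addrC -{1}(mean_cst D r (f x)) -meanD.
by apply: eq_mean => ps; rewrite big_cons.
Qed.

(* Weak duality for the constraint that at most the initial stock is sold in net. *)
Lemma profit_le_dual {R : realType} (D : price_dist R) (B n : nat) (lam : R)
    (ps : seq (R * R)) (acts : seq action) :
  symmetric_prices D -> 0 <= lam -> {subset ps <= finsupp D} -> size acts = size ps ->
  feasible B n acts -> profit ps acts <= \sum_(x <- ps) `|x.1 - lam| + lam * n%:R.
Proof.
move=> symD lam0; elim: ps n acts => [|x ps IH] n [|a acts] // sD sz fA.
  by rewrite /profit !big_nil add0r mulr_ge0.
rewrite /profit /= !big_cons /= -/(profit _ _).
have xD : x \in finsupp D by apply: sD; rewrite mem_head.
have {IH} := IH (restock n a) acts (fun y h => sD y (mem_behead (s := x :: ps) h)) (succn_inj sz).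
move: fA; rewrite feasible_cons => /andP[Ba fA] /(_ fA).
suff : gain x a + lam * (restock n a)%:R <= `|x.1 - lam| + lam * n%:R by lra.
have := ler_norm (x.1 - lam); have := ler_norm (- (x.1 - lam)); rewrite normrN.
have x12 := symD x xD; case: a Ba {sz} fA => /= n0 _.
- by rewrite -natr1; lra.
- by rewrite -[in X in _ <= _ + lam * X](prednK n0) -natr1; lra.
- lra.
Qed.

Lemma offline_profit_le {R : realType} (P : iid_atp R) (lam : R) :
  symmetric_prices (request P) -> 0 <= lam ->
  offline_profit P <= (horizon P)%:R * (\sum_(x <- finsupp (request P)) request P x * `|x.1 - lam|)
    + lam * (inventory P)%:R.
Proof.
move=> symD lam0; rewrite /offline_profit expectation_mean -mean_sum.
rewrite -(mean_cst (request P) (horizon P) (lam * _)) -meanD.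
apply: mean_le => ps sz sD; apply/bigmax_leP; split=> [|acts fA].
  by rewrite addr_ge0 ?sumr_ge0 ?mulr_ge0.
by apply: (profit_le_dual _ _ _ _ _ _ symD lam0 sD _ fA); rewrite size_tuple sz.
Qed.

Lemma offline_profit_ge0 {R : realType} (P : iid_atp R) : 0 <= offline_profit P.
Proof.
rewrite /offline_profit expectation_mean -(mean_cst (request P) (horizon P) 0).
by apply: mean_le => ps _ _; exact: bigmax_ge_id.
Qed.

(** [lam] is the least support price whose cumulative mass reaches [q]. [beta] will be the
    probability of buying; splitting the atom at [lam] makes its mean exactly [q]. *)
Lemma quantile {R : realType} (D : price_dist R) (q : R) : 0 <= q <= 1 ->
  exists (lam : R) (beta : R * R -> R),
    [/\ 0 <= lam,
        forall x, 0 <= beta x <= 1,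
        forall x, x.1 < lam -> beta x = 1,
        forall x, lam < x.1 -> beta x = 0
      & \sum_(x <- finsupp D) D x * beta x = q].
Proof.
case/andP=> q0 q1.
pose cdf (y : R) := \sum_(x <- finsupp D | x.1 <= y) D x.
have [x0 _] : exists x : finsupp D, true.
  case: (fset_0Vmem (finsupp D)) => [D0|[x xD]]; last by exists (FSetSub xD).
  by have := pmf_sum1 D; rewrite D0 big_seq_fset0 => /esym/eqP; rewrite oner_eq0.
pose top := [arg max_(x > x0) (val x).1]%O.
have cdf_top : q <= cdf (val top).1.
  apply: le_trans q1 _; rewrite -(pmf_sum1 D) /cdf big_seq [leRHS]big_seq_cond.
  rewrite le_eqVlt; apply/orP; left; apply/eqP; apply: eq_bigl => x.
  rewrite andb_idr // => xD; rewrite /top; case: arg_maxP => // y _ /(_ (FSetSub xD)).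
  exact.
pose z := [arg min_(x < top | q <= cdf (val x).1) (val x).1]%O.
have [zq zmin] : q <= cdf (val z).1 /\
    forall x : finsupp D, q <= cdf (val x).1 -> (val z).1 <= (val x).1.
  by rewrite /z; case: arg_minP.
set lam := (val z).1 in zq zmin.
pose below := \sum_(x <- finsupp D | x.1 < lam) D x.
pose at_lam := \sum_(x <- finsupp D | x.1 == lam) D x.
have cdfE : cdf lam = below + at_lam.
  rewrite /cdf /below /at_lam (bigID (fun x => x.1 < lam)) /=; congr (_ + _).
    by apply: eq_bigl => x; rewrite andb_idl // => /ltW.
  by apply: eq_bigl => x; rewrite -leNgt eq_le.
(* The mass strictly below [lam] is the cumulative mass at the next smaller support price [w], which
   is less than [q] by minimality of [z]. *)
have below_q : below <= q.
  have [/existsP[y ylt]|none] := boolP [exists y : finsupp D, (val y).1 < lam].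
    pose w := [arg max_(x > y | (val x).1 < lam) (val x).1]%O.
    have [wlt wmax] : (val w).1 < lam /\
        forall x : finsupp D, (val x).1 < lam -> (val x).1 <= (val w).1.
      by rewrite /w; case: arg_maxP.
    have -> : below = cdf (val w).1.
      rewrite /below /cdf big_seq_cond [RHS]big_seq_cond; apply: eq_bigl => x.
      have [xD /=|//] := boolP (x \in finsupp D).
      apply/idP/idP => [/(wmax (FSetSub xD))//|h]; exact: le_lt_trans h wlt.
    by rewrite leNgt; apply/negP => /ltW/zmin; rewrite leNgt wlt.
  rewrite /below big_seq_cond big1 // => x /andP[xD xl].
  by move/existsPn/(_ (FSetSub xD)): none; rewrite xl.
have at0 : 0 <= at_lam by apply: sumr_ge0 => x _; exact: pmf_ge0.
have [th [/andP[th0 th1] thE]] : exists th : R, 0 <= th <= 1 /\ th * at_lam = q - below.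
  (* Without mass at [lam], [below <= q <= cdf lam = below], so nothing remains to be split. *)
  have [a0|a0] := eqVneq at_lam 0.
    by exists 0; rewrite lexx ler01; split=> //; rewrite mul0r; lra.
  have ap : 0 < at_lam by rewrite lt_neqAle eq_sym a0.
  exists ((q - below) / at_lam); rewrite divfK //; split=> //.
  by rewrite divr_ge0 ?ler_pdivrMr ?mul1r //=; lra.
exists lam, (fun x => if x.1 < lam then 1 else if x.1 == lam then th else 0); split.
- by have [] := prices_ge0 (valP z).
- by move=> x; case: ifP; [lra|case: ifP; lra].
- by move=> x ->.
- by move=> x xl; rewrite ltNge (ltW xl) /= gt_eqF.
rewrite (bigID (fun x => x.1 < lam)) /= (_ : q = below + th * at_lam); last by rewrite thE; lra.
congr (_ + _); first by apply: eq_bigr => x ->; rewrite mulr1.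
rewrite (bigID (fun x => x.1 == lam)) /= [X in _ + X]big1 ?addr0.
  rewrite mulr_sumr; apply: eq_big => x; first by case: eqP => [->|]; rewrite ?ltxx ?andbF.
  by case/andP => /negPf-> ->; rewrite mulrC.
by move=> x /andP[/negPf-> /negPf->]; rewrite mulr0.
Qed.

(** * Lower bounds on the online value from simple policies *)

Lemma value_ge0 {R : realType} (D : price_dist R) (B r n : nat) : 0 <= value D B r n.
Proof.
elim: r n => //= r IH n; apply: sumr_ge0 => x _; rewrite mulr_ge0 ?pmf_ge0 //.
by apply: le_trans (bellman_ge Skip isT); rewrite /= add0r.
Qed.

Lemma value_sell {R : realType} (D : price_dist R) (B r n : nat) : (0 < n)%N ->
  \sum_(x <- finsupp D) D x * x.2 + value D B r n.-1 <= value D B r.+1 n.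
Proof.
move=> n0 /=; rewrite addrC -sum_affine; apply: ler_mean => x _.
by rewrite addrC; exact: (bellman_ge Sell n0).
Qed.

Lemma value_buy {R : realType} (D : price_dist R) (B r n : nat) : (n < B)%N ->
  - (\sum_(x <- finsupp D) D x * x.1) + value D B r n.+1 <= value D B r.+1 n.
Proof.
move=> nB /=; rewrite addrC.
have -> : - (\sum_(x <- finsupp D) D x * x.1) = \sum_(x <- finsupp D) D x * - x.1.
  by rewrite -sumrN; apply: eq_bigr => x _; rewrite mulrN.
rewrite -sum_affine; apply: ler_mean => x _.
by rewrite addrC; exact: (bellman_ge Buy nB).
Qed.

(** The Bellman maximum dominates the mixture that buys with probability [beta x] and otherwise
    sells. *)
Lemma value_mix {R : realType} (D : price_dist R) (B r n : nat) (beta : R * R -> R) :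
  (0 < n < B)%N -> (forall x, 0 <= beta x <= 1) ->
  \sum_(x <- finsupp D) D x * ((1 - beta x) * x.2 - beta x * x.1)
    + (\sum_(x <- finsupp D) D x * beta x) * value D B r n.+1
    + (1 - \sum_(x <- finsupp D) D x * beta x) * value D B r n.-1 <= value D B r.+1 n.
Proof.
case/andP=> n0 nB beta01 /=.
set V1 := value D B r n.+1; set V0 := value D B r n.-1.
have -> : \sum_(x <- finsupp D) D x * ((1 - beta x) * x.2 - beta x * x.1)
    + (\sum_(x <- finsupp D) D x * beta x) * V1
    + (1 - \sum_(x <- finsupp D) D x * beta x) * V0 =
  \sum_(x <- finsupp D) D x * (beta x * (- x.1 + V1) + (1 - beta x) * (x.2 + V0)).
  rewrite -[X in X - _](pmf_sum1 D) -sumrB !mulr_suml -!big_split /=.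
  by apply: eq_bigr => x _; ring.
apply: ler_mean => x _.
have := bellman_ge (f := value D B r) (x := x) Buy nB.
have := bellman_ge (B := B) (f := value D B r) (x := x) Sell n0.
rewrite /= -/V1 -/V0; set b := bellman _ _ _ _ => h1 h2.
have /andP[b0 b1] := beta01 x.
have : beta x * (- x.1 + V1) <= beta x * b by rewrite ler_wpM2l.
have : (1 - beta x) * (x.2 + V0) <= (1 - beta x) * b by rewrite ler_wpM2l // subr_ge0.
lra.
Qed.

Lemma value_liquidate {R : realType} (D : price_dist R) (B r n : nat) : (n <= r)%N ->
  n%:R * (\sum_(x <- finsupp D) D x * x.2) <= value D B r n.
Proof.
elim: r n => [|r IH] [|n] // nr; rewrite ?mul0r ?value_ge0 //.
apply: le_trans (value_sell _ _ _ _ (ltn0Sn n)).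
by rewrite -natr1 mulrDl mul1r addrC lerD2l IH.
Qed.

(** * The supermartingale that counts departures from the dual optimum *)

Definition pos {R : realType} (y : R) : R := Num.max y 0.

Lemma pos_cases {R : realType} (y : R) : (0 <= y /\ pos y = y) \/ (y <= 0 /\ pos y = 0).
Proof. by rewrite /pos; have [h|/ltW h] := leP 0 y; [left|right]. Qed.

(** The truncated square is nondecreasing, so [q <= 1 / 2] reduces to the symmetric step, where its
    second difference is at most 2. *)
Lemma pos_sqr_curvature {R : realType} (q y : R) : 0 <= q -> q <= 1 / 2 ->
  q * pos (y + 1) ^+ 2 + (1 - q) * pos (y - 1) ^+ 2 <= pos y ^+ 2 + 1.
Proof.
move=> q0 q1; set f1 := pos (y + 1) ^+ 2; set f0 := pos (y - 1) ^+ 2.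
have f10 : f0 <= f1.
  rewrite /f0 /f1.
  case: (pos_cases (y + 1)) => -[? ->]; case: (pos_cases (y - 1)) => -[? ->]; nra.
have : (f1 + f0) / 2 <= pos y ^+ 2 + 1.
  rewrite /f0 /f1; case: (pos_cases (y + 1)) => -[? ->];
  case: (pos_cases (y - 1)) => -[? ->]; case: (pos_cases y) => -[? ->]; nra.
nra.
Qed.

(* Bounds the expected number of steps, among the last [r] ones and starting from the stock [n],
   at which the policy departs from the dual optimum.  The quadratic term controls the variance
   of the deviation [n - delta r] from the fluid path, the linear term the pushes at an empty
   stock and the truncated square those at a full one. *)
Definition regret {R : realType} (delta s b r n : R) : R :=
  (n - delta * r) ^+ 2 / s - 2 * (n - delta * r) + 4 * (pos (s - b + n) ^+ 2 / s)
  + 8 * (r / s) + 14 * s.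

Lemma regret_endgame {R : realType} (delta s b r n : R) : 1 <= s -> 0 <= r ->
  4 * (n - delta * r + 1) + 1 <= regret delta s b r n.
Proof.
move=> s1 r0; rewrite /regret; set d := n - delta * r.
have si : 0 < s^-1 by rewrite invr_gt0; lra.
(* This square turns the quadratic term into at least [6 d - 9 s]; of [14 s] there remains [5 s],
   which is at least 5. *)
have : 0 <= (d - 3 * s) ^+ 2 / s by rewrite mulr_ge0 ?sqr_ge0 // ltW.
have -> : (d - 3 * s) ^+ 2 / s = d ^+ 2 / s - 6 * d + 9 * s by field; lra.
have : 0 <= pos (s - b + n) ^+ 2 / s by rewrite mulr_ge0 ?sqr_ge0 // ltW.
have : 0 <= r / s by rewrite mulr_ge0 // ltW.
lra.
Qed.

(** A forced purchase lowers the linear term by [2 + 2 delta]; the time term [8 / s] absorbs the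
    increase of the two squares. *)
Lemma regret_empty {R : realType} (delta s b r : R) : 1 <= s -> s <= b ->
  0 <= delta -> delta <= 1 -> 0 <= r ->
  regret delta s b r 1 + 2 <= regret delta s b (r + 1) 0.
Proof.
move=> s1 sb d0 d1 r0; rewrite -subr_ge0.
have p0 : 0 <= pos (s - b + 0) ^+ 2 by exact: sqr_ge0.
have p1 : pos (s - b + 1) ^+ 2 <= 1 by case: (pos_cases (s - b + 1)) => -[? ->]; nra.
have -> : regret delta s b (r + 1) 0 - (regret delta s b r 1 + 2) =
  ((0 - delta * (r + 1)) ^+ 2 - (1 - delta * r) ^+ 2
   + 4 * (pos (s - b + 0) ^+ 2 - pos (s - b + 1) ^+ 2) + 8) / s + 2 * delta.
  by rewrite /regret; field; lra.
rewrite addr_ge0 //; last lra.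
rewrite mulr_ge0 ?invr_ge0; [|nra|lra].
have : 0 <= delta * r by rewrite mulr_ge0.
nra.
Qed.

(** Here the linear term works the wrong way by at most 2, but the truncated square falls from
    [s ^ 2] to [(s - 1) ^ 2], which with its weight is worth [8 - 4 / s]. The fluid path lies below
    [b], so selling hardly raises the quadratic term. *)
Lemma regret_full {R : realType} (delta s b r : R) : 1 <= s -> 0 <= delta -> delta <= 1 ->
  delta * (r + 1) <= b ->
  regret delta s b r (b - 1) + 2 <= regret delta s b (r + 1) b.
Proof.
move=> s1 d0 d1 rb; rewrite -subr_ge0.
have p0 : pos (s - b + b) = s by rewrite subrK /pos; apply: max_l; lra.
have p1 : pos (s - b + (b - 1)) = s - 1 by rewrite addrA subrK /pos; apply: max_l; lra.
have -> : regret delta s b (r + 1) b - (regret delta s b r (b - 1) + 2) =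
  ((b - delta * (r + 1)) ^+ 2 - (b - delta * (r + 1) - (1 - delta)) ^+ 2 + 4) / s
   + 4 + 2 * delta.
  by rewrite /regret p0 p1; field; lra.
rewrite addr_ge0 //; last lra.
rewrite addr_ge0 //.
rewrite mulr_ge0 ?invr_ge0; [|nra|lra].
have : 0 <= (b - delta * (r + 1)) * (1 - delta) by rewrite mulr_ge0; lra.
nra.
Qed.

(** Buying with probability [q] gives the stock drift [- delta], so [n - delta r] is a martingale.
    Per step the quadratic term grows by [(1 - delta ^ 2) / s] and the truncated square, with its
    weight, by at most [4 / s]; the time term pays [8 / s]. *)
Lemma regret_interior {R : realType} (delta s b r n q : R) : 1 <= s -> 0 <= delta ->
  delta <= 1 -> q = (1 - delta) / 2 ->
  q * regret delta s b r (n + 1) + (1 - q) * regret delta s b r (n - 1)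
    <= regret delta s b (r + 1) n.
Proof.
move=> s1 d0 d1 qE; rewrite -subr_ge0.
have q0 : 0 <= q by rewrite qE; lra.
have q1 : q <= 1 / 2 by rewrite qE; lra.
have := @pos_sqr_curvature R q (s - b + n) q0 q1; rewrite -!addrA !addrA => curv.
have -> : regret delta s b (r + 1) n -
  (q * regret delta s b r (n + 1) + (1 - q) * regret delta s b r (n - 1)) =
  (4 * (pos (s - b + n) ^+ 2 + 1 - (q * pos (s - b + n + 1) ^+ 2
     + (1 - q) * pos (s - b + n - 1) ^+ 2)) + 3 + delta ^+ 2) / s.
  by rewrite /regret !addrA qE; field; lra.
rewrite mulr_ge0 ?invr_ge0; [|nra|lra] => //.
Qed.

(** Backward induction on the remaining time: an interior step earns its full dual profit, and each
    forced trade loses at most [2 u] with [u = m + delta lam], paid by a drop of 2 in [regret]. *)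
Lemma value_ge_regret {R : realType} (D : price_dist R) (B T : nat) (delta lam s : R)
    (beta : R * R -> R) (m := \sum_(x <- finsupp D) D x * `|x.1 - lam|) :
  symmetric_prices D -> 1 <= s -> s <= B%:R -> 0 <= delta -> delta <= 1 ->
  delta * T%:R <= B%:R -> 0 <= lam -> (forall x, 0 <= beta x <= 1) ->
  (forall x, x.1 < lam -> beta x = 1) -> (forall x, lam < x.1 -> beta x = 0) ->
  \sum_(x <- finsupp D) D x * beta x = (1 - delta) / 2 ->
  forall r n, (r <= T)%N -> (n <= r)%N -> (n <= B)%N -> (1 < B)%N ->
  lam * n%:R + r%:R * m - (m + delta * lam) * regret delta s B%:R r%:R n%:R
    <= value D B r n.
Proof.
move=> symD s1 sB d0 d1 dT lam0 beta01 betalt betagt betaE.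
(* [up] and [dn] are the selling and buying shares of [m]. Compared with the dual step, a forced
   purchase loses [2 up] and a forced sale [2 dn]. *)
pose up := \sum_(x <- finsupp D) D x * ((1 - beta x) * (x.1 - lam)).
pose dn := \sum_(x <- finsupp D) D x * (beta x * (lam - x.1)).
have absE (x : R * R) : `|x.1 - lam| = (1 - beta x) * (x.1 - lam) + beta x * (lam - x.1).
  case: (ltgtP x.1 lam) => h.
  - by rewrite betalt // ltr0_norm ?subr_lt0 //; ring.
  - by rewrite betagt // gtr0_norm ?subr_gt0 //; ring.
  - by rewrite h subrr normr0; ring.
have mE : m = up + dn.
  by rewrite /m /up /dn -big_split; apply: eq_bigr => x _; rewrite absE mulrDr.
have up0 : 0 <= up.
  apply: sumr_ge0 => x _; rewrite mulr_ge0 ?pmf_ge0 //.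
  have /andP[b0 b1] := beta01 x; have [/betalt->|h] := ltP x.1 lam; nra.
have dn0 : 0 <= dn.
  apply: sumr_ge0 => x _; rewrite mulr_ge0 ?pmf_ge0 //.
  have /andP[b0 b1] := beta01 x; have [/betagt->|h] := ltP lam x.1; nra.
have dn_le : 2 * dn <= lam * (1 - delta).
  have -> : lam * (1 - delta) = 2 * (lam * ((1 - delta) / 2)) by field.
  rewrite ler_pM2l // -betaE mulr_sumr /dn !big_seq; apply: ler_sum => x xD.
  rewrite [leRHS]mulrCA ler_wpM2l ?pmf_ge0 //.
  have [p0 _] := prices_ge0 xD; have /andP[b0 b1] := beta01 x; nra.
have avgE : \sum_(x <- finsupp D) D x * x.1 = lam + up - dn.
  have -> : lam + up - dn = lam + \sum_(x <- finsupp D) D x * (x.1 - lam).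
    by rewrite -addrA -sumrB; congr (_ + _); apply: eq_bigr => x _; ring.
  by rewrite -sum_affine; apply: eq_bigr => x _; rewrite addrC subrK.
have avg2E : \sum_(x <- finsupp D) D x * x.2 = lam + up - dn.
  by rewrite -avgE !big_seq; apply: eq_bigr => x /symD->.
have mixE : \sum_(x <- finsupp D) D x * ((1 - beta x) * x.2 - beta x * x.1) = m + delta * lam.
  have -> : m + delta * lam = lam + (m - 2 * lam * ((1 - delta) / 2)) by field.
  have -> : m - 2 * lam * ((1 - delta) / 2) =
      \sum_(x <- finsupp D) D x * (`|x.1 - lam| - 2 * lam * beta x).
    by rewrite -betaE mulr_sumr -sumrB; apply: eq_bigr => x _; ring.
  rewrite -sum_affine !big_seq.
  by apply: eq_bigr => x /symD <-; rewrite absE; ring.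
set u := m + delta * lam.
have m0 : 0 <= m by rewrite mE addr_ge0.
have u_ge : m <= u by rewrite lerDl mulr_ge0.
have u0 : 0 <= u by exact: le_trans u_ge.
(* Selling until the end loses at most [m + 2 n dn], which the lower bound of [regret_endgame]
   covers. *)
have endgame r n : (r <= n.+1)%N -> (n <= r)%N ->
    lam * n%:R + r%:R * m - u * regret delta s B%:R r%:R n%:R <= value D B r n.
  move=> rn nr; apply: le_trans (value_liquidate D B r n nr); rewrite avg2E.
  have rn' : r%:R <= n%:R + 1 :> R by rewrite natr1 ler_nat.
  have nr' : n%:R <= r%:R :> R by rewrite ler_nat.
  have n0' : 0 <= n%:R :> R by exact: ler0n.
  have := @regret_endgame R delta s B%:R r%:R n%:R s1 (ler0n _ _).
  set Psi := regret _ _ _ _ _; set d := n%:R - delta * r%:R => Psi_ge.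
  have d_ge : (1 - delta) * n%:R <= d + 1 by rewrite /d; nra.
  have : u * (4 * (d + 1) + 1) <= u * Psi by rewrite ler_wpM2l.
  suff : m + 2 * n%:R * dn <= u * (4 * (d + 1) + 1).
    have : r%:R * m <= (n%:R + 1) * m by rewrite ler_wpM2r.
    rewrite mE; lra.
  have d1' : 0 <= d + 1 by apply: le_trans d_ge; rewrite mulr_ge0 // subr_ge0.
  have ud : 0 <= u * (d + 1) by rewrite mulr_ge0.
  suff : n%:R * (2 * dn) <= 4 * (u * (d + 1)) by lra.
  (* For small [delta], [n] itself is at most [2 (d + 1)]. For large [delta], [dn] is small because
     its mean involves only a [(1 - delta) / 2] fraction of the mass, and [u] is at least
     [lam / 2]. *)
  have [dh|dh] := leP delta (1 / 2).
    have n2 : n%:R <= 2 * (d + 1) by nra.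
    have : n%:R * (2 * dn) <= n%:R * (2 * u) by rewrite ler_wpM2l //; lra.
    have : n%:R * (2 * u) <= 2 * (d + 1) * (2 * u) by rewrite ler_wpM2r //; lra.
    lra.
  have : n%:R * (2 * dn) <= n%:R * (lam * (1 - delta)) by rewrite ler_wpM2l.
  have : lam * ((1 - delta) * n%:R) <= lam * (d + 1) by rewrite ler_wpM2l.
  have : lam * (d + 1) <= 2 * u * (d + 1) by rewrite ler_wpM2r // /u; nra.
  lra.
elim=> [|r IH] n rT nr nB B2; first exact: endgame.
(* Liquidation already starts at [n = r] with [r.+1] requests left, so that a purchase never pushes
   the stock above the remaining time. *)
have [rn|nr1] := leqP r n; first exact: endgame.
have r1E : r.+1%:R = r%:R + 1 :> R by rewrite natr1.
have [n0|n0] := posnP n.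
  rewrite n0; have := value_buy D B r 0 (ltnW B2).
  rewrite avgE; have := IH 1%N (ltnW rT) _ (ltnW B2) B2; rewrite -n0 => /(_ nr1).
  have := @regret_empty R delta s B%:R r%:R s1 sB d0 d1 (ler0n _ _).
  rewrite n0 r1E; set Psi1 := regret _ _ _ _ 1; set Psi0 := regret _ _ _ _ 0 => Psi01.
  have : u * (Psi1 + 2) <= u * Psi0 by rewrite ler_wpM2l.
  lra.
have [nltB|] := ltnP n B; last first.
  move=> Bn; have nE : n = B by apply/eqP; rewrite eqn_leq nB.
  rewrite {n Bn}nE in nr nB nr1 n0 *.
  have := value_sell D B r B n0; rewrite avg2E.
  have Br : (B.-1 <= r)%N by rewrite -ltnS prednK.
  have := IH B.-1 (ltnW rT) Br (leq_pred _) B2.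
  have B1E : B.-1%:R = B%:R - 1 :> R by rewrite -{2}(prednK n0) -natr1; ring.
  have dr : delta * (r%:R + 1) <= B%:R.
    by apply: le_trans dT; rewrite -r1E ler_wpM2l // ler_nat.
  have := @regret_full R delta s B%:R r%:R s1 d0 d1 dr.
  rewrite B1E r1E; set Psi1 := regret _ _ _ _ (_ - 1); set Psi0 := regret _ _ _ _ _ => Psi01.
  have : u * (Psi1 + 2) <= u * Psi0 by rewrite ler_wpM2l.
  lra.
have := value_mix D B r n beta _ beta01; rewrite n0 nltB => /(_ isT).
rewrite mixE betaE -/u; set q := (1 - delta) / 2.
have := IH n.+1 (ltnW rT) nr1 nltB B2.
have := IH n.-1 (ltnW rT) (leq_trans (leq_pred n) (ltnW nr1)) (leq_trans (leq_pred n) nB) B2.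
have n1E : n.-1%:R = n%:R - 1 :> R by rewrite -{2}(prednK n0) -natr1; ring.
have := @regret_interior R delta s B%:R r%:R n%:R q s1 d0 d1 erefl.
rewrite n1E -natr1 r1E; set Psi1 := regret _ _ _ _ (_ + 1);
  set Psi0 := regret _ _ _ _ (_ - 1); set Psi := regret _ _ _ _ _ => Psi01 h0 h1.
have q0 : 0 <= q by rewrite /q; lra.
have q1 : 0 <= 1 - q by rewrite /q; lra.
have := ler_wpM2l q0 h1; have := ler_wpM2l q1 h0.
have : u * (q * Psi1 + (1 - q) * Psi0) <= u * Psi by rewrite ler_wpM2l.
have : lam * (2 * q) = lam * (1 - delta) by rewrite /q; field.
rewrite /u; lra.
Qed.

Lemma value_ge_offline {R : realType} (P : iid_atp R) :
  symmetric_prices (request P) -> (1 <= inventory P)%N -> (2 <= capacity P)%N ->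
  exists2 U : R, offline_profit P <= U &
    (1 - 44 / Num.sqrt (capacity P)%:R) * U <=
      value (request P) (capacity P) (horizon P) (inventory P).
Proof.
move=> symD n0_gt0 B2.
have := inventory_capacity P; have := inventory_horizon P; have := capacity_horizon P.
have off := offline_profit_le P _ symD; move: off.
set D := request P in symD *; set B := capacity P in B2 *; set T := horizon P.
set n0 := inventory P in n0_gt0 * => off BnT nT nB.
have T0 : 0 < T%:R :> R by rewrite ltr0n; lia.
pose delta : R := n0%:R / T%:R.
have d0 : 0 <= delta by rewrite divr_ge0.
have d1 : delta <= 1 by rewrite ler_pdivrMr // mul1r ler_nat.
have dT : delta * T%:R = n0%:R by rewrite divfK ?gt_eqF.
have [|lam [beta [lam0 beta01 betalt betagt betaE]]] := quantile D ((1 - delta) / 2).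
  by apply/andP; split; lra.
have {}off := off lam lam0.
set m := \sum_(x <- _) _ in off.
pose u := m + delta * lam.
(* By [delta T = n0] this is the dual bound [T m + lam n0]. *)
exists (T%:R * u).
  by apply: le_trans off _; rewrite /u -dT; lra.
pose s : R := Num.sqrt B%:R; rewrite -/s.
have ss : s * s = B%:R by rewrite -expr2 sqr_sqrtr.
have s0 : 0 <= s by exact: sqrtr_ge0.
have B1 : 1 <= B%:R :> R by rewrite ler1n; lia.
have s1 : 1 <= s by nra.
have sB : s <= B%:R by nra.
have s_gt0 : 0 < s by lra.
have dTB : delta * T%:R <= B%:R by rewrite dT ler_nat.
have := value_ge_regret D B T delta lam s beta symD s1 sB d0 d1 dTB lam0 beta01 betalt betagt
  betaE T n0 (leqnn T) nT nB B2.
apply: le_trans; rewrite -/m -/u /regret dT subrr expr0n /= mul0r mulr0 subr0 add0r.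
have pos_s : pos (s - B%:R + n0%:R) ^+ 2 <= s ^+ 2.
  have : n0%:R <= B%:R :> R by rewrite ler_nat.
  by move=> ?; case: (pos_cases (s - B%:R + n0%:R)) => -[? ->]; nra.
have pos_ss : pos (s - B%:R + n0%:R) ^+ 2 / s <= s.
  by rewrite ler_pdivrMr // -expr2.
have BT : B%:R <= 2 * T%:R :> R by rewrite -natrM ler_nat mul2n -addnn (leq_trans BnT) // leq_add2r.
have sT : s <= 2 * (T%:R / s) by rewrite mulrA ler_pdivlMr // ss.
have m0 : 0 <= m by apply: sumr_ge0 => x _; rewrite mulr_ge0 ?pmf_ge0.
have u0 : 0 <= u by rewrite addr_ge0 // mulr_ge0.
have -> : (1 - 44 / s) * (T%:R * u) = T%:R * u - u * (44 * (T%:R / s)) by ring.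
have -> : lam * n0%:R = T%:R * (delta * lam) by rewrite -dT; ring.
set p := pos _ ^+ 2 / s in pos_ss *.
(* The initial stock lies on the fluid path. As [p <= s] and [s <= 2 T / s], from
   [B <= n0 + T <= 2 T], the constant is [4 * 2 + 8 + 14 * 2 = 44]. *)
have : u * (4 * p + 8 * (T%:R / s) + 14 * s) <= u * (44 * (T%:R / s)).
  by rewrite ler_wpM2l //; lra.
rewrite {3}/u; lra.
Qed.

(** Turns the error [44 / sqrt B] into [88 ln B / sqrt B]. *)
Lemma ln_nat_ge (R : realType) (B : nat) : (2 <= B)%N -> 1 / 2 <= ln B%:R :> R.
Proof.
move=> B2; rewrite -[leLHS]expRK ler_ln ?posrE ?expR_gt0 ?ltr0n //; last lia.
have : 1 + - (1 / 2) <= expR (- (1 / 2)) :> R by exact: expR_ge1Dx.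
rewrite expRN => h; have e0 : 0 < expR (1 / 2) :> R by exact: expR_gt0.
have : (1 / 2) * expR (1 / 2) <= 1 :> R.
  by rewrite -ler_pdivlMr // [leRHS]mul1r; lra.
have : 2 <= B%:R :> R by rewrite ler_nat.
lra.
Qed.

Lemma online_guarantee (R : realType) (P : iid_atp R) :
  symmetric_prices (request P) -> (1 <= inventory P)%N -> (2 <= capacity P)%N ->
  exists A : algorithm R, is_online P A /\
    (1 - 88 * (ln (capacity P)%:R / Num.sqrt (capacity P)%:R)) * offline_profit P
      <= online_profit P A.
Proof.
move=> symD n0 B2; have [A onA AE] := value_attained P; exists A; split=> //; rewrite AE.
have [U offU] := value_ge_offline P symD n0 B2.
have := value_ge0 (request P) (capacity P) (horizon P) (inventory P).
set V := value _ _ _ _; set B := capacity P in B2 *; move=> V0.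
have off0 := offline_profit_ge0 P.
have si : 0 <= (Num.sqrt B%:R)^-1 :> R by rewrite invr_ge0 sqrtr_ge0.
have := ler_wpM2r si (ln_nat_ge R B B2); set i := _^-1 in si *; set l := ln _ * i => li.
(* [U] may be replaced by the smaller offline profit only when its factor is nonnegative; otherwise
   nonnegativity of the value suffices. *)
have [neg|nneg] := lerP (1 - 44 * i) 0 => UV; first by apply: le_trans V0; nra.
have : (1 - 44 * i) * offline_profit P <= (1 - 44 * i) * U by rewrite ler_wpM2l // ltW.
have : (1 - 88 * l) * offline_profit P <= (1 - 44 * i) * offline_profit P.
  by rewrite ler_wpM2r //; lra.
lra.
Qed.

(** * The hard instance *)

(** An extra copy is worth between 0 and the top price 2. The side condition keeps the capacity out
    of reach during the [r] remaining requests. *)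
Definition slopes {R : realType} (B r : nat) (f : nat -> R) : Prop :=
  forall n, (n.+1 + r <= B)%N -> f n <= f n.+1 <= f n + 2.

Definition low_price {R : realType} (x : R * R) : Prop := x.1 = x.2 /\ 0 <= x.1 <= 2.

(** Each stock imitates the action of the other, except that the smaller one skips when the larger
    one sells, losing at most 2. *)
Lemma bellman_slopes {R : realType} (B r : nat) (x : R * R) (f : nat -> R) :
  low_price x -> slopes B r f -> slopes B r.+1 (fun n => bellman B x n f).
Proof.
move=> [x12 /andP[x0 x2]] sf n; rewrite addnS => nB.
have fB m : (m <= n.+1)%N -> f m <= f m.+1 <= f m + 2.
  by move=> mn; apply: sf; apply: leq_trans nB; rewrite addSn ltnS leq_add2r.
have nB' : (n.+1 < B)%N by apply: leq_ltn_trans nB; rewrite leq_addr.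
apply/andP; split; apply: bellman_le => -[] /=.
- move=> _; apply: le_trans (bellman_ge Buy _) => //=.
  by rewrite lerD2l; case/andP: (fB n.+1 (leqnn _)).
- case: n {nB nB'} fB => // n fB _; apply: le_trans (bellman_ge (B := B) Sell _) => //=.
  by rewrite lerD2l; case/andP: (fB n (leq_trans (leqnSn _) (leqnSn _))).
- move=> _; apply: le_trans (bellman_ge (B := B) Skip _) => //=.
  by rewrite lerD2l; case/andP: (fB n (leqnSn _)).
- move=> _; rewrite -lerBlDr; apply: le_trans (bellman_ge Buy _) => /=; last exact: ltnW.
  by case/andP: (fB n.+1 (leqnn _)); lra.
- move=> _; rewrite -lerBlDr; apply: le_trans (bellman_ge (B := B) Skip _) => //=.
  lra.
- move=> _; rewrite -lerBlDr; apply: le_trans (bellman_ge (B := B) Skip _) => //=.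
  by case/andP: (fB n (leqnSn _)); lra.
Qed.

Lemma hindsight_slopes {R : realType} (B : nat) (ps : seq (R * R)) :
  (forall x, x \in ps -> low_price x) -> slopes B (size ps) (fun n => hindsight B n ps).
Proof.
elim: ps => [|x ps IH] low /=; first by move=> n _; rewrite lexx /= add0r ler0n.
apply: bellman_slopes; first by apply: low; rewrite mem_head.
by apply: IH => y yps; apply: low; rewrite inE yps orbT.
Qed.

Lemma value_slopes {R : realType} (D : price_dist R) (B r : nat) :
  (forall x, x \in finsupp D -> low_price x) -> slopes B r (value D B r).
Proof.
move=> low; elim: r => [|r IH] n nB /=; first by rewrite lexx add0r ler0n.
apply/andP; split.
  by apply: ler_mean => x /low lx; case/andP: (bellman_slopes _ _ _ _ lx IH n nB).
rewrite addrC -sum_affine; apply: ler_mean => x /low lx; rewrite addrC.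
by case/andP: (bellman_slopes _ _ _ _ lx IH n nB).
Qed.

Lemma bellman_free {R : realType} (B r n : nat) (f : nat -> R) :
  slopes B r f -> (n + r < B)%N -> bellman B (0, 0) n f = f n.+1.
Proof.
move=> sf nB; apply/eqP; rewrite eq_le; apply/andP; split; last first.
  apply: le_trans (bellman_ge Buy _) => /=; first by rewrite oppr0 add0r.
  exact: leq_ltn_trans (leq_addr r n) nB.
have fn : f n <= f n.+1 by case/andP: (sf n nB).
apply: bellman_le => -[] /=; rewrite ?oppr0 ?add0r // => n0.
apply: le_trans fn; have nB1 : (n.-1.+1 + r <= B)%N by rewrite prednK // ltnW.
by have /andP[+ _] := sf n.-1 nB1; rewrite prednK.
Qed.

Lemma bellman_dear {R : realType} (B r n : nat) (f : nat -> R) :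
  slopes B r f -> (n + r < B)%N ->
  bellman B (2, 2) n f = if n is n'.+1 then 2 + f n' else f 0%N.
Proof.
move=> sf nB; apply/eqP; rewrite eq_le; apply/andP; split; last first.
  case: n nB => [|n] nB; last exact: (bellman_ge (x := (2, 2)) (n := n.+1) (f := f) Sell isT).
  by apply: le_trans (bellman_ge (B := B) Skip _) => //=; rewrite add0r.
have /andP[fn fn2] := sf n nB.
case: n nB fn fn2 => [|n] nB fn fn2; apply: bellman_le => -[] //=; try lra.
  have /andP[? ?] := sf n (ltnW nB); lra.
move=> _; have /andP[? ?] := sf n (ltnW nB); lra.
Qed.

(* [survives n ps]: starting with [n] copies, buying only at 0 and selling at 1 and 2, every sale
   is possible. *)
Fixpoint survives {R : realType} (n : nat) (ps : seq (R * R)) : bool :=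
  if ps is x :: ps' then
    if x.1 == 0 then survives n.+1 ps' else if n is n'.+1 then survives n' ps' else false
  else true.

(* [starves n ps]: starting with [n] copies, some sale at 2 is missed even if one buys at 0 and 1
   and sells only at 2. *)
Fixpoint starves {R : realType} (n : nat) (ps : seq (R * R)) : bool :=
  if ps is x :: ps' then
    if x.1 == 2 then if n is n'.+1 then starves n' ps' else true else starves n.+1 ps'
  else false.

Lemma starvesW {R : realType} (n : nat) (ps : seq (R * R)) : starves n.+1 ps -> starves n ps.
Proof.
by elim: ps n => //= x ps IH [|n]; case: ifP => // _; exact: IH.
Qed.

Definition three_prices {R : realType} : seq (R * R) := [:: (0, 0); (1, 1); (2, 2)].

Lemma three_prices_low {R : realType} (x : R * R) : x \in three_prices -> low_price x.
Proof. by rewrite !inE => /or3P[] /eqP->; split => //=; lra. Qed.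

Lemma hindsight_le_total {R : realType} (B n : nat) (ps : seq (R * R)) :
  {subset ps <= three_prices} -> hindsight B n ps <= \sum_(x <- ps) x.1.
Proof.
elim: ps n => [|x ps IH] n sub; first by rewrite big_nil.
rewrite big_cons /=; apply: bellman_le => a _; apply: lerD; last first.
  by apply: IH => y yps; apply: sub; rewrite inE yps orbT.
have [x12 /andP[x0 _]] := three_prices_low x (sub x (mem_head _ _)).
by case: a => /=; lra.
Qed.

(** The trivial bound by the total of all prices is attained, so that further copies are
    worthless. *)
Lemma hindsight_survives {R : realType} (B n : nat) (ps : seq (R * R)) :
  {subset ps <= three_prices} -> (n + size ps <= B)%N -> survives n ps ->
  hindsight B n ps = \sum_(x <- ps) x.1.
Proof.
move=> sub nB sv; apply/eqP; rewrite eq_le hindsight_le_total //=.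
elim: ps n sub nB sv => [|x ps IH] n sub nB; first by rewrite big_nil.
have sub' : {subset ps <= three_prices} by move=> y yps; apply: sub; rewrite inE yps orbT.
have [x12 _] := three_prices_low x (sub x (mem_head _ _)).
move: nB; rewrite /= addnS => nB; case: eqP => [x0 sv|_].
  apply: le_trans (bellman_ge Buy _) => /=; last exact: leq_ltn_trans (leq_addr _ _) nB.
  by rewrite big_cons x0 oppr0 !add0r IH.
case: n nB => [//|n] nB sv.
apply: le_trans (bellman_ge (B := B) Sell _) => //=.
by rewrite big_cons -x12 lerD2l; apply: IH => //; rewrite ltnW // ltnW.
Qed.

Lemma survivesS {R : realType} (n : nat) (ps : seq (R * R)) : survives n ps -> survives n.+1 ps.
Proof.
by elim: ps n => //= x ps IH [|n]; case: ifP => // _; exact: IH.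
Qed.

(** An extra copy can serve the missed sale at 2. The larger stock copies the optimal actions of the
    smaller one until then. *)
Lemma hindsight_starves {R : realType} (B n : nat) (ps : seq (R * R)) :
  {subset ps <= three_prices} -> (n + size ps < B)%N -> starves n ps ->
  hindsight B n ps + 2 <= hindsight B n.+1 ps.
Proof.
elim: ps n => [|x ps IH] n sub //; rewrite [size _]/= addnS => nB.
have sub' : {subset ps <= three_prices} by move=> y yps; apply: sub; rewrite inE yps orbT.
have xin := sub x (mem_head _ _).
have low y : y \in ps -> low_price y by move/sub'/three_prices_low.
have sl := hindsight_slopes B ps low.
have nB' : (n + size ps < B)%N by exact: ltnW.
have nB2 : (n.+1 + size ps < B)%N by [].
move: xin; rewrite !inE => /or3P[] /eqP-> /=.
- rewrite (bellman_free B (size ps)) // (bellman_free B (size ps) n.+1) //.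
  by rewrite lt_eqF ?ltr0n // => st; exact: IH.
(* [starves] allows for a purchase at the middle price, so by monotonicity it persists after every
   action. *)
- rewrite lt_eqF ?ltr1n // => st; rewrite -lerBrDr.
  apply: bellman_le => -[] /= aB.
  + have := IH n.+1 sub' nB2 st.
    have := bellman_ge (x := (1, 1)) (f := fun n' => hindsight B n' ps) (B := B) (n := n.+1) Buy.
    move=> /(_ (leq_ltn_trans (leq_addr _ _) nB2)) /=; lra.
  + case: n nB nB' nB2 st aB => // n nB nB' nB2 st _ /=.
    have := IH n sub' (ltnW nB') (starvesW _ _ (starvesW _ _ st)).
    have := bellman_ge (x := (1, 1)) (f := fun n' => hindsight B n' ps) (B := B) (n := n.+2)
      Sell isT.
    by rewrite /=; lra.
  + have := IH n sub' nB' (starvesW _ _ st).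
    have := bellman_ge (x := (1, 1)) (f := fun n' => hindsight B n' ps) (B := B) (n := n.+1)
      Skip isT.
    by rewrite /=; lra.
- rewrite eqxx (bellman_dear B (size ps)) // (bellman_dear B (size ps) n.+1) //.
  case: n nB nB' nB2 => [|n] nB nB' nB2 st; first by rewrite addrC.
  by rewrite -addrA lerD2l IH // ltnW.
Qed.

(* At the middle price, selling, skipping and buying are wrong by at least 1 on the futures
   with [starves], [starves] and [survives] respectively. *)
Lemma hindsight_mid {R : realType} (B n : nat) (ps : seq (R * R)) (a : action) :
  {subset ps <= three_prices} -> (n + size ps < B)%N -> allowed B n a ->
  gain (1, 1) a + hindsight B (restock n a) ps
    + (if a is Buy then survives n ps else starves n ps)%:R
  <= bellman B (1, 1) n (fun n' => hindsight B n' ps).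
Proof.
move=> sub nB aB.
have wait := bellman_ge (x := (1, 1)) (f := fun n' => hindsight B n' ps) (B := B) (n := n) Skip isT.
case: a aB => aB.
- case: (boolP (survives n ps)) => [sv|_]; last first.
    by rewrite addr0; exact: (bellman_ge (f := fun n' => hindsight B n' ps)).
  move: wait; rewrite /= (hindsight_survives B n.+1) // ?(hindsight_survives B n) //; first lra.
    exact: ltnW.
  exact: survivesS.
- case: (boolP (starves n ps)) => [st|_]; last first.
    by rewrite addr0; exact: (bellman_ge (f := fun n' => hindsight B n' ps)).
  case: n nB aB st wait => // n nB _ st /=.
  have := hindsight_starves B n ps sub (ltnW nB) (starvesW _ _ st); lra.
- case: (boolP (starves n ps)) => [st|_]; last by rewrite addr0.
  have := hindsight_starves B n ps sub nB st.
  have := bellman_ge (x := (1, 1)) (f := fun n' => hindsight B n' ps) (B := B) (n := n) Buy.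
  by move=> /(_ (leq_ltn_trans (leq_addr _ _) nB)) /=; lra.
Qed.

(** * Survival and starvation probabilities of the three-price walk *)

Definition three_point {R : realType} (D : price_dist R) (e : R) : Prop :=
  {subset finsupp D <= three_prices} /\
  forall f : R * R -> R, \sum_(x <- finsupp D) D x * f x =
    (1 - e) / 2 * f (0, 0) + e * f (1, 1) + (1 - e) / 2 * f (2, 2).

Lemma three_point_exists {R : realType} (e : R) : 0 <= e <= 1 ->
  exists D : price_dist R, three_point D e.
Proof.
case/andP=> e0 e1; pose S : {fset R * R} := [fset x in three_prices]%fset.
pose w : {fsfun R * R -> R with 0} :=
  [fsfun x in S => if x == (1, 1) then e else (1 - e) / 2 | 0].
have wS : (finsupp w `<=` S)%fset by exact: finsupp_sub.
have uniq3 : uniq (@three_prices R).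
  by rewrite /= !inE !xpair_eqE !lt_eqF ?ltr1n.
have memS x : (x \in S) = (x \in three_prices) by exact: in_fset.
have sumE (f : R * R -> R) : \sum_(x <- finsupp w) w x * f x =
    (1 - e) / 2 * f (0, 0) + e * f (1, 1) + (1 - e) / 2 * f (2, 2).
  (* For [e] equal to 0 or 1 the support is smaller than [S]; the added terms are zero. *)
  have -> : \sum_(x <- finsupp w) w x * f x = \sum_(x <- S) w x * f x.
    apply: big_fset_incl wS _ => x _ /=; rewrite memNfinsupp => /eqP->.
    by rewrite mul0r.
  have /(perm_big _)-> : perm_eq S three_prices.
    by apply: uniq_perm => // x; rewrite memS.
  rewrite !big_cons big_nil /w !fsfun_fun !memS !mem_head !inE !eqxx !orbT.
  by rewrite !xpair_eqE lt_eqF ?ltr01 // [2 == 1]gt_eqF ?ltr1n //= addr0 addrA.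
have w0 x : 0 <= w x.
  by rewrite /w fsfun_fun; case: ifP => // _; case: ifP => // _; lra.
have w1 : \sum_(x <- finsupp w) w x = 1.
  under eq_bigr => x _ do rewrite -[w x]mulr1.
  by rewrite (sumE (fun=> 1)); field.
have wp x : x \in finsupp w -> 0 <= x.1 /\ 0 <= x.2.
  move=> /(fsubsetP wS); rewrite memS => /three_prices_low[<- /andP[? _]]; by split.
exists (@PriceDist R w w0 w1 wp); split=> // x /(fsubsetP wS); by rewrite memS.
Qed.

(* [1 - mean] is dominated by the harmonic-like function
   [y / L + 2 y (L - y) / r + (1 - j / r)] with [y = n + 1]: before leaving [(0, L)] the walk
   exits at [L] with probability about [y / L], and its exit time has mean about [y (L - y)]. *)
Lemma mean_starves_ge {R : realType} (D : price_dist R) (e r : R) (L : nat) :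
  three_point D e -> 0 <= e <= 1 -> 0 < r -> (0 < L)%N -> e * L%:R <= 1 / 4 ->
  e * r <= L%:R / 2 ->
  forall j n, j%:R <= r -> (n < L)%N ->
  j%:R / r - n.+1%:R / L%:R - 2 * (n.+1%:R * (L%:R - n.+1%:R) / r)
    <= mean D j (fun ps => (starves n ps)%:R).
Proof.
move=> [_ sumE] /andP[e0 e1] r0 L0 eL er.
have Lp : 0 < L%:R :> R by rewrite ltr0n.
have ri : 0 < r^-1 by rewrite invr_gt0.
have Li : 0 < (L%:R)^-1 :> R by rewrite invr_gt0.
elim=> [|j IH] n jr nL.
  have nL' : n.+1%:R <= L%:R :> R by rewrite ler_nat.
  have : 0 <= n.+1%:R / L%:R :> R by rewrite mulr_ge0 // ltW.
  have : 0 <= n.+1%:R * (L%:R - n.+1%:R) / r :> R.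
    by rewrite mulr_ge0 ?mulr_ge0 ?subr_ge0 // ltW.
  rewrite /= mul0r; lra.
have j1r : j%:R <= r by apply: le_trans jr; rewrite ler_nat.
have mean0 i m : 0 <= mean D i (fun ps => (starves m ps)%:R) :> R.
  by rewrite -(mean_cst D i 0); apply: mean_le.
have [nL1|nL1] := ltnP n.+1 L; last first.
  have -> : L = n.+1 by apply/eqP; rewrite eqn_leq nL1.
  apply: le_trans (mean0 j.+1 n); rewrite subrr mulr0 mul0r divff ?pnatr_eq0 //.
  have : j.+1%:R / r <= 1 by rewrite ler_pdivrMr // mul1r.
  lra.
rewrite [leRHS]/= sumE /= eqxx [0 == 2]lt_eqF ?ltr0n // [1 == 2]lt_eqF ?ltr1n //=.
set up := mean D j (fun ps => (starves n.+1 ps)%:R).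
set dn := mean D j _.
have up_ge : j%:R / r - n.+2%:R / L%:R - 2 * (n.+2%:R * (L%:R - n.+2%:R) / r) <= up.
  exact: IH.
have dn_ge : j%:R / r - n%:R / L%:R - 2 * (n%:R * (L%:R - n%:R) / r) <= dn.
  rewrite /dn; case: n nL {nL1 up up_ge dn} => [|n] nL; last by apply: IH => //; exact: ltnW.
  rewrite mean_cst !mul0r mulr0 !subr0.
  by rewrite ler_pdivrMr // mul1r.
apply: le_trans (_ : (1 + e) / 2 * (j%:R / r - n.+2%:R / L%:R
      - 2 * (n.+2%:R * (L%:R - n.+2%:R) / r))
  + (1 - e) / 2 * (j%:R / r - n%:R / L%:R - 2 * (n%:R * (L%:R - n%:R) / r)) <= _); last first.
  have : (1 + e) / 2 * (j%:R / r - n.+2%:R / L%:R - 2 * (n.+2%:R * (L%:R - n.+2%:R) / r))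
    <= (1 + e) / 2 * up by rewrite ler_wpM2l //; lra.
  have : (1 - e) / 2 * (j%:R / r - n%:R / L%:R - 2 * (n%:R * (L%:R - n%:R) / r))
    <= (1 - e) / 2 * dn by rewrite ler_wpM2l //; lra.
  lra.
rewrite -subr_ge0 -[n.+2%:R]natr1 -[n.+1%:R]natr1 -[j.+1%:R]natr1.
set x : R := n%:R; set l : R := L%:R.
(* The one-step drift of the comparison function; each of the two smallness hypotheses on [e] costs
   at most half of the leading 1. *)
have -> : (1 + e) / 2 * (j%:R / r - (x + 1 + 1) / l - 2 * ((x + 1 + 1) * (l - (x + 1 + 1)) / r))
  + (1 - e) / 2 * (j%:R / r - x / l - 2 * (x * (l - x) / r))
  - ((j%:R + 1) / r - (x + 1) / l - 2 * ((x + 1) * (l - (x + 1)) / r))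
  = (1 - 2 * (e * l) + 4 * (e * (x + 1)) - e * r / l) / r.
  by field; rewrite !gt_eqF.
rewrite mulr_ge0 //; last exact: ltW.
have : e * r / l <= 1 / 2 by rewrite ler_pdivrMr //; lra.
have : 0 <= e * (x + 1) by rewrite mulr_ge0 // addr_ge0.
rewrite -/l in eL; lra.
Qed.

(** With [y = n + 1], the function [y (l - y)] is at most [l ^ 2 / 4], vanishes at ruin [y = 0], and
    decreases by at most 2 per step on average since [e l <= 1]. *)
Lemma mean_survives_ge {R : realType} (D : price_dist R) (e l : R) :
  three_point D e -> 0 <= e <= 1 -> 0 < l -> e * l <= 1 ->
  forall j n,
  4 / l ^+ 2 * (n.+1%:R * (l - n.+1%:R) - 2 * j%:R)
    <= mean D j (fun ps => (survives n ps)%:R).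
Proof.
move=> [_ sumE] /andP[e0 e1] l0 el.
have c0 : 0 < 4 / l ^+ 2 by rewrite divr_gt0 // exprn_gt0.
elim=> [|j IH] n.
  rewrite /= mulr0 subr0 mulrAC ler_pdivrMr ?exprn_gt0 // mul1r.
  have := sqr_ge0 (l - 2 * n.+1%:R); lra.
rewrite [leRHS]/= sumE /= eqxx oner_eq0 pnatr_eq0 /=.
set up := mean D j (fun ps => (survives n.+1 ps)%:R).
set dn := mean D j _.
have up_ge : 4 / l ^+ 2 * (n.+2%:R * (l - n.+2%:R) - 2 * j%:R) <= up by exact: IH.
have dn_ge : 4 / l ^+ 2 * (n%:R * (l - n%:R) - 2 * j%:R) <= dn.
  rewrite /dn; case: n {up up_ge dn} => [|n]; last exact: IH.
  by rewrite mean_cst mul0r sub0r mulrN oppr_le0; apply: mulr_ge0; [exact: ltW|exact: mulr_ge0].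
have : (1 - e) / 2 * (4 / l ^+ 2 * (n.+2%:R * (l - n.+2%:R) - 2 * j%:R)) <= (1 - e) / 2 * up.
  by rewrite ler_wpM2l //; lra.
have : (1 + e) / 2 * (4 / l ^+ 2 * (n%:R * (l - n%:R) - 2 * j%:R)) <= (1 + e) / 2 * dn.
  by rewrite ler_wpM2l //; lra.
suff : 4 / l ^+ 2 * (n.+1%:R * (l - n.+1%:R) - 2 * j.+1%:R) <=
   4 / l ^+ 2 * ((1 - e) / 2 * (n.+2%:R * (l - n.+2%:R) - 2 * j%:R)
     + (1 + e) / 2 * (n%:R * (l - n%:R) - 2 * j%:R)) by lra.
rewrite ler_pM2l // -[n.+2%:R]natr1 -[n.+1%:R]natr1 -[j.+1%:R]natr1.
have : 0 <= e * (n%:R + 1) by rewrite mulr_ge0 // addr_ge0.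
lra.
Qed.

(** A maximum of means is at most the mean of the maximum. *)
Lemma value_le_hindsight {R : realType} (D : price_dist R) (B r n : nat) :
  value D B r n <= mean D r (hindsight B n).
Proof.
elim: r n => //= r IH n; apply: ler_mean => x _; apply: bellman_le => a aB.
apply: (@le_trans _ _ (gain x a + mean D r (hindsight B (restock n a)))).
  by rewrite lerD2l.
rewrite -{1}(mean_cst D r (gain x a)) -meanD; apply: mean_le => ps _ _.
exact: (bellman_ge (f := fun n' => hindsight B n' ps)).
Qed.

(** With [t] the elapsed time, it is positive only while the stock is within [w] of [c] and
    [t < w ^ 2]. *)
Definition window {R : realType} (w c t n : R) : R := w ^+ 2 - (n - c) ^+ 2 - t.

(* The online decisions at the middle price steer the stock adversarially; [window] is chosen so
   that, whatever these decisions, it loses at most 3 per step on average, hence counts the steps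
   spent with the stock within [w] of [c]. *)
Lemma hindsight_gap {R : realType} (D : price_dist R) (e c0 w c : R) (B T : nat) :
  three_point D e -> 0 <= e <= 1 -> 0 <= c0 -> 1 <= w -> 2 * (w * e) <= 1 ->
  w <= c -> w ^+ 2 <= T%:R ->
  (forall r n, (r < T)%N -> T%:R - w ^+ 2 < r.+1%:R -> c - w < n%:R -> n%:R < c + w ->
     c0 <= mean D r (fun ps => (survives n ps)%:R) /\
     c0 <= mean D r (fun ps => (starves n ps)%:R)) ->
  forall r n, (r <= T)%N -> (n + r <= B)%N ->
  value D B r n + e * c0 / 3 * pos (window w c (T%:R - r%:R) n%:R)
    <= mean D r (hindsight B n).
Proof.
move=> tD /andP[e0 e1] c0_ge0 w1 we wc wT luck.
have [sub sumE] := tD.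
have k0 : 0 <= e * c0 / 3 by rewrite divr_ge0 ?mulr_ge0.
set kap := e * c0 / 3 in k0 *.
have low x : x \in finsupp D -> low_price x by move/sub/three_prices_low.
elim=> [|r IH] n rT nB.
  rewrite /= add0r subr0 /pos max_r ?mulr0 // /window.
  by have := sqr_ge0 (n%:R - c); lra.
have [out|inn] := lerP (window w c (T%:R - r.+1%:R) n%:R) 0.
  by rewrite /pos max_r // mulr0 addr0; exact: value_le_hindsight.
rewrite [pos _]/pos max_l; last exact: ltW.
set psi := window _ _ _ _ in inn *.
have r1E : r.+1%:R = r%:R + 1 :> R by rewrite natr1.
have d2 : (n%:R - c) ^+ 2 < w ^+ 2.
  have : r.+1%:R <= T%:R :> R by rewrite ler_nat.
  by move: inn; rewrite /psi /window; lra.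
have [dlo dhi] : - w < n%:R - c /\ n%:R - c < w by split; nra.
have [|||sv st] := luck r n rT; [|lra|lra|].
  by move: inn; rewrite /psi /window; have := sqr_ge0 (n%:R - c); lra.
have nB' : (n + r < B)%N by rewrite -addnS.
have n0 : (0 < n)%N.
  by rewrite lt0n; apply/eqP => nE; move: dlo; rewrite nE; lra.
have ih m : (m + r <= B)%N ->
    value D B r m + kap * window w c (T%:R - r%:R) m%:R <= mean D r (hindsight B m).
  move=> mB; apply: le_trans (IH m (ltnW rT) mB); rewrite lerD2l ler_wpM2l //.
  by rewrite /pos le_max lexx.
have up := ih n.+1 nB'.
have dn := ih n.-1 (leq_trans (leq_add (leq_pred n) (leqnn r)) (ltnW nB')).
(* Whichever action is chosen is wrong by at least 1 with probability at least [c0], and moves the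
   stock by at most 1, which costs the window at most [2 w + 2]. *)
have mid : bellman B (1, 1) n (value D B r) + c0 + kap * (psi - 2 * w - 2)
    <= mean D r (fun ps => bellman B (1, 1) n (fun n' => hindsight B n' ps)).
  rewrite -lerBrDr -lerBrDr; apply: bellman_le => a aB.
  have ha : (restock n a + r <= B)%N.
    by case: (a) => //=; [exact: leq_trans (leq_add (leq_pred n) (leqnn r)) (ltnW nB')|exact: ltnW].
  have near : kap * (psi - 2 * w - 2) <= kap * window w c (T%:R - r%:R) (restock n a)%:R.
    rewrite ler_wpM2l // /psi /window r1E.
    have n1E : n.-1%:R = n%:R - 1 :> R by rewrite -{2}(prednK n0) -natr1; ring.
    by case: (a) => /=; rewrite -?natr1 ?n1E; nra.
  have gap : gain (1, 1) a + mean D r (hindsight B (restock n a)) + c0 <=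
      mean D r (fun ps => bellman B (1, 1) n (fun n' => hindsight B n' ps)).
    apply: (@le_trans _ _ (mean D r (fun ps => gain (1, 1) a + hindsight B (restock n a) ps +
      (if a is Buy then survives n ps else starves n ps)%:R))).
      rewrite !meanD mean_cst lerD2l; case: (a) => //.
    apply: mean_le => ps sz subp; apply: hindsight_mid; rewrite ?sz //.
    by move=> x /subp/sub.
  have := ih _ ha; lra.
have sl := value_slopes D B r low.
rewrite [value _ _ _ _]/= [mean _ _ _]/= !sumE (bellman_free B r) // (bellman_dear B r) //.
have free : mean D r (hindsight B n.+1) <=
    mean D r (fun ps => bellman B (0, 0) n (fun n' => hindsight B n' ps)).
  apply: mean_le => ps sz subp; rewrite (bellman_free B r) // -sz.
  by apply: hindsight_slopes => x /subp/low.
have dear : 2 + mean D r (hindsight B n.-1) <=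
    mean D r (fun ps => bellman B (2, 2) n (fun n' => hindsight B n' ps)).
  rewrite -{1}(mean_cst D r 2) -meanD; apply: mean_le => ps sz subp.
  by apply: le_trans (bellman_ge (B := B) Sell _) => //=.
have -> : (if n is n'.+1 then 2 + value D B r n' else value D B r 0) = 2 + value D B r n.-1.
  by case: (n) n0.
set F0 := mean D r (fun ps => bellman B (0, 0) n (fun n' => hindsight B n' ps)) in free *.
set F1 := mean D r (fun ps => bellman B (1, 1) n (fun n' => hindsight B n' ps)) in mid *.
set F2 := mean D r (fun ps => bellman B (2, 2) n (fun n' => hindsight B n' ps)) in dear *.
set V1 := bellman _ _ _ _ in mid *.
set wu := window w c (T%:R - r%:R) n.+1%:R in up.
set wd := window w c (T%:R - r%:R) n.-1%:R in dn.
have h0 : (1 - e) / 2 * (value D B r n.+1 + kap * wu) <= (1 - e) / 2 * F0.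
  by rewrite ler_wpM2l; [|lra|lra].
have h2 : (1 - e) / 2 * (2 + value D B r n.-1 + kap * wd) <= (1 - e) / 2 * F2.
  by rewrite ler_wpM2l; [|lra|lra].
have h1 : e * (V1 + c0 + kap * (psi - 2 * w - 2)) <= e * F1 by rewrite ler_wpM2l.
have wE : wu + wd = 2 * (psi - 2).
  have n1E : n.-1%:R = n%:R - 1 :> R by rewrite -{2}(prednK n0) -natr1; ring.
  by rewrite /wu /wd /psi /window n1E -[n.+1%:R]natr1 r1E; ring.
have hw : (1 - e) / 2 * (kap * wu) + (1 - e) / 2 * (kap * wd) = (1 - e) * (kap * (psi - 2)).
  by rewrite -mulrDr -mulrDr wE; field.
(* The window loses 2 per step off the middle price and at most [2 w + 2] on it, on average
   [2 + 2 w e <= 3]; the gain [e c0 = 3 kap] pays for this. *)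
have hk : kap * (2 * (w * e)) <= kap by rewrite -[leRHS]mulr1 ler_wpM2l.
have kE : e * c0 = 3 * kap by rewrite /kap; field.
lra.
Qed.

(** * Parameters of the instance, with an integer [k] of order [sqrt B] *)

Lemma square_scale (B : nat) : (1024 <= B)%N ->
  exists2 k, (0 < k)%N & (32 * 32 * k ^ 2 <= B < 64 * 64 * k ^ 2)%N.
Proof.
move=> B1; pose p k := (32 * 32 * k ^ 2 <= B)%N.
have p1 : exists k, p k by exists 1%N; rewrite /p exp1n muln1.
have pB k : p k -> (k <= B)%N by rewrite /p => pk; nia.
case: (ex_maxnP p1 pB) => k pk kmax.
have k0 : (0 < k)%N by apply: kmax; rewrite /p exp1n muln1.
exists k => //; apply/andP; split=> //; rewrite ltnNge; apply/negP => big.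
(* Since [k + 1 <= 2 k], a larger [B] would admit [k + 1]. *)
have : (k.+1 <= k)%N by apply: kmax; rewrite /p; nia.
by rewrite ltnn.
Qed.

(** In the window the stock is between [2 k] and [4 k] and the remaining time is of order [k ^ 2],
    so both events have constant probability. Survival is compared at the scale [l = 1 / e],
    starvation at the level [16 k]. *)
Lemma walk_estimates (R : realType) (D : price_dist R) (k T : nat) :
  three_point D (50 * 100 * k%:R)^-1 -> (0 < k)%N ->
  31 * 31 * k%:R ^+ 2 <= T%:R :> R -> T%:R <= 64 * 64 * k%:R ^+ 2 :> R ->
  forall r n, (r < T)%N -> T%:R - k%:R ^+ 2 < r.+1%:R :> R ->
    3 * k%:R - k%:R < n%:R :> R -> n%:R < 3 * k%:R + k%:R :> R ->
  1 / 40 / 100 <= mean D r (fun ps => (survives n ps)%:R) /\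
  1 / 40 / 100 <= mean D r (fun ps => (starves n ps)%:R).
Proof.
move=> tD k0 T1 T2 r n rT; set K : R := k%:R in tD T1 T2 *.
have K1 : 1 <= K by rewrite ler1n.
set e := _^-1 in tD; have eK : e * K = 1 / 50 / 100 by rewrite /e; field; lra.
have e0 : 0 <= e by rewrite invr_ge0; lra.
have e1 : e <= 1 by nra.
have rT' : r%:R <= T%:R :> R by rewrite ler_nat ltnW.
rewrite -natr1 => rlo nlo nhi.
have KK : K <= K ^+ 2 by nra.
have rlo' : 30 * 30 * K ^+ 2 <= r%:R by lra.
have r0 : 0 < r%:R :> R by nra.
have nhi' : n.+1%:R <= 4 * K.
  have : (n < 4 * k)%N by rewrite -(ltr_nat R) natrM -/K; lra.
  by rewrite -(ler_nat R) natrM -/K.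
have nlo' : 2 * K <= n.+1%:R by rewrite -natr1; lra.
split.
  have e01 : 0 <= e <= 1 by rewrite e0.
  have L0 : 0 < 50 * 100 * K by lra.
  have eL : e * (50 * 100 * K) <= 1 by rewrite mulrCA eK; lra.
  apply: le_trans (mean_survives_ge D e (50 * 100 * K) tD e01 L0 eL r n).
  rewrite [leRHS]mulrAC ler_pdivlMr ?exprn_gt0 //.
  nra.
have e01 : 0 <= e <= 1 by rewrite e0.
have LE : (16 * k)%:R = 16 * K :> R by rewrite natrM.
have L0 : (0 < 16 * k)%N by rewrite muln_gt0.
have eL : e * (16 * k)%:R <= 1 / 4 by rewrite LE mulrCA eK; lra.
have er : e * r%:R <= (16 * k)%:R / 2.
  have : e * r%:R <= e * (64 * 64 * K ^+ 2) by rewrite ler_wpM2l //; lra.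
  have -> : e * (64 * 64 * K ^+ 2) = 64 * 64 * (e * K) * K by ring.
  by rewrite eK LE; lra.
have nL : (n < 16 * k)%N by rewrite -(ltr_nat R) LE; lra.
apply: le_trans (mean_starves_ge D e r%:R (16 * k) tD e01 r0 L0 eL er r n (lexx _) nL).
rewrite LE divff ?gt_eqF //.
have : n.+1%:R / (16 * K) <= 1 / 4 by rewrite ler_pdivrMr; lra.
have : n.+1%:R * (16 * K - n.+1%:R) / r%:R <= 1 / 8.
  by rewrite ler_pdivrMr //; nra.
lra.
Qed.

Lemma hardness (R : realType) (B : nat) : (1024 <= B)%N ->
  exists P : iid_atp R,
    [/\ capacity P = B, symmetric_prices (request P), (1 <= inventory P)%N,
        0 < offline_profit P
      & forall A : algorithm R, is_online P A ->
          online_profit P A <=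
            (1 - 1 / 50 / 100 / 40 / 100 / 400 / Num.sqrt B%:R) * offline_profit P].
Proof.
move=> /square_scale[k k0 /andP[Blo Bhi]].
(* Stock and horizon add up to [B], so even buying at every request respects the capacity. *)
pose T := (B - 3 * k)%N.
have [c1 c2 c3] : [/\ (1 <= B)%N, (3 * k <= B)%N & (3 * k <= T)%N] by rewrite /T; split; nia.
have c4 : (B <= 3 * k + T)%N by rewrite /T; lia.
have Tk : (31 * 31 * k ^ 2 <= T)%N by rewrite /T; nia.
have T0 : (T <= B)%N by exact: leq_subr.
have BT : (3 * k + T <= B)%N by rewrite /T subnKC.
move: T c3 c4 Tk T0 BT => T c3 c4 Tk T0 BT.
pose K : R := k%:R; have K1 : 1 <= K by rewrite ler1n.
pose e : R := (50 * 100 * K)^-1; have eK : e * K = 1 / 50 / 100 by rewrite /e; field; lra.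
have e0 : 0 <= e by rewrite invr_ge0; lra.
have e01 : 0 <= e <= 1 by rewrite e0 /=; nra.
have [D tD] := three_point_exists e e01; have [sub sumE] := tD.
exists (@IidATP R T B (3 * k) D c1 c2 c3 c4).
set P := IidATP _ _ _ _ _.
have KT : 31 * 31 * K ^+ 2 <= T%:R by rewrite -natrX -!natrM ler_nat.
have BK : B%:R < 64 * 64 * K ^+ 2 by rewrite -natrX -!natrM ltr_nat.
have TB : T%:R <= B%:R :> R by rewrite ler_nat.
have TK : T%:R <= 64 * 64 * K ^+ 2 by lra.
have we : 2 * (K * e) <= 1 by rewrite mulrC [K * e]mulrC eK; lra.
have wc : K <= 3 * K by lra.
have wT : K ^+ 2 <= T%:R by nra.
have c0 : 0 <= 1 / 40 / 100 :> R by lra.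
have := hindsight_gap D e (1 / 40 / 100) K (3 * K) B T tD e01 c0 K1 we wc wT
  (walk_estimates R D k T tD k0 KT TK) T (3 * k)%N (leqnn T) BT.
(* The stock starts at the centre of the window, so the absolute gap is of order [e K ^ 2], that is,
   of order [K]. *)
have -> : pos (window K (3 * K) (T%:R - T%:R) (3 * k)%:R) = K ^+ 2.
  by rewrite natrM /window !subrr expr0n /= !subr0 /pos max_l ?sqr_ge0.
have -> : e * (1 / 40 / 100) / 3 * K ^+ 2 = 1 / 50 / 100 / 40 / 100 / 3 * K.
  by rewrite -[1 / 50 / 100]eK; field.
set V := value _ _ _ _ => gap.
have off : mean D T (hindsight B (3 * k)) <= offline_profit P.
  rewrite /offline_profit expectation_mean; apply: mean_le => ps sz _.
  exact: (hindsight_le_max_profit P).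
have off_le : mean D T (fun ps => \sum_(x <- ps) x.1) <= 2 * B%:R.
  rewrite mean_sum sumE /=.
  have /andP[_ ?] := e01; have : 0 <= T%:R :> R by [].
  nra.
have symD : symmetric_prices D by move=> x /sub/three_prices_low[].
have V0 : 0 <= V by exact: value_ge0.
have gap0 : 0 < 1 / 50 / 100 / 40 / 100 / 3 * K by nra.
have off0 : 0 < mean D T (hindsight B (3 * k)) by lra.
split=> //=.
- by rewrite muln_gt0.
- exact: lt_le_trans off.
move=> A onA; have := online_profit_le_value P A onA; rewrite -/V => AV.
apply: le_trans AV _.
have hs_le : mean D T (hindsight B (3 * k)) <= 2 * B%:R.
  apply: le_trans off_le; apply: mean_le => ps sz subp.
  by apply: hindsight_le_total => x /subp/sub.
pose s : R := Num.sqrt B%:R; rewrite -/s.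
have ss : s * s = B%:R by rewrite -expr2 sqr_sqrtr.
have s0 : 0 < s by rewrite sqrtr_gt0 ltr0n.
have sK : s <= 64 * K by nra.
have cs : 1 / 50 / 100 / 40 / 100 / 400 / s <= 1 by rewrite ler_pdivrMr // mul1r; nra.
apply: (@le_trans _ _ ((1 - 1 / 50 / 100 / 40 / 100 / 400 / s)
    * mean D T (hindsight B (3 * k)))); last first.
  by rewrite ler_wpM2l // subr_ge0.
(* The hindsight profit is at most [2 B] and [sqrt B <= 64 K], so the factor 400 suffices against
   the gap because [2 * 64 * 3 <= 400]. *)
have : 1 / 50 / 100 / 40 / 100 / 400 / s * mean D T (hindsight B (3 * k)) <=
    1 / 50 / 100 / 40 / 100 / 400 / s * (2 * B%:R).
  by rewrite ler_wpM2l // divr_ge0 ?ltW //; lra.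
have -> : 1 / 50 / 100 / 40 / 100 / 400 / s * (2 * B%:R) = 1 / 50 / 100 / 40 / 100 / 200 * s.
  by rewrite -ss; field; lra.
lra.
Qed.

Theorem theorem1p5 (R : realType) :
  (exists C : R, 0 < C /\
     forall P : iid_atp R,
       symmetric_prices (request P) -> (1 <= inventory P)%N ->
       (2 <= capacity P)%N ->
       exists A : algorithm R, is_online P A /\
         (1 - C * (ln (capacity P)%:R / Num.sqrt (capacity P)%:R))
           * offline_profit P <= online_profit P A)
  /\
  (exists (c : R) (n0 : nat), 0 < c /\
     forall B : nat, (n0 <= B)%N ->
       exists P : iid_atp R,
         [/\ capacity P = B,
             symmetric_prices (request P),
             (1 <= inventory P)%N,
             0 < offline_profit P
           & forall A : algorithm R, is_online P A ->
               online_profit P A <=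
                 (1 - c / Num.sqrt B%:R) * offline_profit P]).
Proof.
split; first by exists 88; split; [lra|exact: online_guarantee].
by exists (1 / 50 / 100 / 40 / 100 / 400), 1024%N; split; [lra|exact: hardness].
Qed.
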